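(* Let $d \ge 2$ and $h \ge 2$ be integers, let $T^h_d$ be the balanced $d$-ary tree of height $h$, and let $min_h = (d-1)h/2 + 1$. Then for every fractional root-pebbling $\pi$ of $T^h_d$ (with the root of $T^h_d$ as the distinguished node) there is a time $t$ such that $w_\pi(t) \ge min_h$.
   Context: Height convention: $T^h_d$ is the complete rooted tree in which every non-leaf node has exactly $d$ children and every root-to-leaf path contains exactly $h$ nodes (so $T^2_d$ is a root with $d$ leaf children); edges are directed so that a node's value depends on its children. A fractional pebble configuration assigns to each node $i$ a pair of real numbers $(b(i), w(i))$ with $b(i), w(i) \ge 0$ and $b(i)+w(i) \le 1$; $b(i)$ is the black pebble weight, $w(i)$ the white pebble weight, and $b(i)+w(i)$ the pebble weight of node $i$. A fractional pebble move changes one configuration into another by one of: (i) for any node $i$, decrease $b(i)$ arbitrarily (keeping it $\ge 0$); (ii) for any node $i$, if every child of $i$ has pebble weight $1$, decrease $w(i)$ to $0$, increase $b(i)$ arbitrarily (keeping $b(i)+w(i)\le 1$), and optionally decrease the black pebble weights of the children of $i$ arbitrarily, all simultaneously; (iii) for any node $i$, increase $w(i)$ so that $b(i)+w(i)=1$; (iv) for any leaf $i$, increase $b(i)$ arbitrarily (keeping $b(i)+w(i)\le 1$). A fractional pebbling $\pi$ is a sequence of moves $m_1, m_2, \ldots$ producing configurations $c_0, c_1, c_2, \ldots$, where $c_t$ (the configuration at time $t$) is the configuration after move $m_t$. The weight $w_\pi(t)$ is the sum of the pebble weights of all nodes in $c_t$. A root-pebbling is a pebbling in which the initial and final configurations have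 all pebble weights $0$ and at some time $t$ the root has pebble weight $1$. *)

(* Defs.v *)
From mathcomp Require Import all_boot all_order all_algebra.
From mathcomp Require Import reals.

Set Implicit Arguments.
Unset Strict Implicit.
Unset Printing Implicit Defensive.

Import Order.TTheory GRing.Theory Num.Theory.
Local Open Scope ring_scope.

(* A node of T^h_d is its address, the sequence of branch choices leading to it
   from the root.  A node at depth k lies on a path with k + 1 nodes from the
   root, so that the addresses are the sequences of size at most h - 1.  The
   encoding is meant for h >= 1 (for h = 0 it would give T^1_d). *)
Definition node (d h : nat) : finType := {bseq h.-1 of 'I_d}.

Definition root_node (d h : nat) : node d h := [bseq].

Definition child (d h : nat) (i j : node d h) : bool :=
  [exists a : 'I_d, (j : seq 'I_d) == rcons i a].

Definition leaf (d h : nat) (i : node d h) : bool :=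
  ~~ [exists j, child i j].

Record config (R : realType) (d h : nat) := Config {
  black : node d h -> R;
  white : node d h -> R;
  black_ge0 : forall i, 0 <= black i;
  white_ge0 : forall i, 0 <= white i;
  pebble_le1 : forall i, black i + white i <= 1
}.

Definition pebble (R : realType) (d h : nat) (c : config R d h)
    (i : node d h) : R :=
  black c i + white c i.

Definition weight (R : realType) (d h : nat) (c : config R d h) : R :=
  \sum_(i : node d h) pebble c i.

(* "Increase" and "decrease" allow a zero change.  A leaf satisfies vacuously
   the condition of compute_node on the children. *)
Inductive move (R : realType) (d h : nat) (c c' : config R d h) : Prop :=
| decrease_black (i : node d h) of
    black c' i <= black c i
  & (forall j, j != i -> black c' j = black c j)
  & (forall j, white c' j = white c j)
| compute_node (i : node d h) of
    (forall j, child i j -> pebble c j = 1)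
  & white c' i = 0
  & black c i <= black c' i
  & (forall j, child i j -> black c' j <= black c j)
  & (forall j, j != i -> ~~ child i j -> black c' j = black c j)
  & (forall j, j != i -> white c' j = white c j)
| increase_white (i : node d h) of
    white c i <= white c' i
  & pebble c' i = 1
  & (forall j, j != i -> white c' j = white c j)
  & (forall j, black c' j = black c j)
| increase_leaf_black (i : node d h) of
    leaf i
  & black c i <= black c' i
  & (forall j, j != i -> black c' j = black c j)
  & (forall j, white c' j = white c j).

(* The pebbling with n moves and configurations c 0, ..., c n; the values of c
   beyond n are irrelevant. *)
Definition pebbling (R : realType) (d h n : nat) (c : nat -> config R d h) :
    Prop :=
  forall t, (t < n)%N -> move (c t) (c t.+1).

Definition root_pebbling (R : realType) (d h n : nat)
    (c : nat -> config R d h) : Prop :=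
  [/\ pebbling n c,
      forall i, pebble (c 0%N) i = 0,
      forall i, pebble (c n) i = 0
    & exists2 t, (t <= n)%N & pebble (c t) (root_node d h) = 1].

Definition min_weight (R : realType) (d h : nat) : R :=
  (d%:R - 1) * h%:R / 2 + 1.

(* Main.v *)
Require Import Defs.
From mathcomp Require Import all_boot all_order all_algebra.
From mathcomp Require Import reals boolp.
From mathcomp Require Import zify lra.
Set Implicit Arguments.
Unset Strict Implicit.
Unset Printing Implicit Defensive.
Import Order.TTheory GRing.Theory Num.Theory.
Local Open Scope ring_scope.

(** Let [v s] be the weight, at time [s], of a subtree whose root carries weight
    1 at time [t].  For [a < t < e] with [v a + v e < 1], the weight must peak
    around the value [m] attached to the height of the subtree: before [t] at
    [m + c - v e], or after [t] at [m + 1 - c - v a], or on both sides at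
    heights adding up to [2 m] ([peaks]).  This is proved by induction on the
    height, with [c = 0] for height 2 and [c = 1 / 2] above; at [v a = v e = 0]
    it gives the theorem.

    Siblings: at a time [t] when all [d] children of a node carry weight 1, call
    a pair of times [s < t < r] bad if some child subtree has [v s + v r < 1].
    Outside the bad pairs the subtrees together weigh at least [d] on [s] and
    [r] combined, hence two high values of one subtree, or a left peak and a
    right peak of two different ones, give total weight [2 m + d - 1] on two
    times.  The innermost bad pairs form a staircase, each with a left or a
    right peak of the offending subtree.  The peak at one end of the staircase
    cannot be a left one, the peak at the other end cannot be a right one, and a
    left peak next to a right peak is excluded by the count above.

    Parent: the black weight of the node can only increase, and its white
    weight only decrease, at times when all children carry weight 1.  The last
    such time before [t] and the first one after it supply the peaks, to which
    the black, respectively white, weight still on the node is added. *)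

(** * Extremal times *)

Lemma ex_least_nat (P : nat -> Prop) :
  (exists n, P n) -> exists n, P n /\ forall k, P k -> (n <= k)%N.
Proof.
move=> [n0 Pn0]; have exP : exists n, `[< P n >] by exists n0; apply/asboolP.
case: (ex_minnP exP) => n /asboolP Pn nmin.
by exists n; split=> // k Pk; apply: nmin; apply/asboolP.
Qed.

Lemma ex_greatest_nat (P : nat -> Prop) (N : nat) :
  (exists n, P n) -> (forall n, P n -> (n <= N)%N) ->
  exists n, P n /\ forall k, P k -> (k <= n)%N.
Proof.
move=> [n0 Pn0] leN; have exP : exists n, `[< P n >] by exists n0; apply/asboolP.
have ubP n : `[< P n >] -> (n <= N)%N by move/asboolP/leN.
case: (ex_maxnP exP ubP) => n /asboolP Pn nmax.
by exists n; split=> // k Pk; apply: nmax; apply/asboolP.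
Qed.

Lemma ex_argmin_nat (R : realDomainType) (f : nat -> R) (a b : nat) :
  (a <= b)%N ->
  exists2 k, (a <= k <= b)%N & forall j, (a <= j <= b)%N -> f k <= f j.
Proof.
elim: b => [|b IHb] ab.
  by exists a => [|j jab]; [lia | rewrite (_ : j = a); [|lia]].
have [eab|{}/IHb [k kab kmin]] : a = b.+1 \/ (a <= b)%N by lia.
  by exists a => [|j jab]; [lia | rewrite (_ : j = a); [|lia]].
have [fk|fk] := leP (f k) (f b.+1).
  exists k => [|j jab]; first lia.
  by have [->|jb] := eqVneq j b.+1; last by apply: kmin; lia.
exists b.+1 => [|j jab]; first lia.
by have [->//|jb] := eqVneq j b.+1; apply: ltW (lt_le_trans fk _); apply: kmin; lia.
Qed.

Ltac nat_range :=
  repeat match goal with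
  | H : is_true (Order.le _ _) |- _ => clear H
  | H : is_true (Order.lt _ _) |- _ => clear H
  | H : is_true (andb _ _) |- _ => case/andP: H => ? ?
  end;
  repeat (apply/andP; split); lia.

(** * Sums whose terms are at least 1, with one or two exceptions *)

Section SumBounds.
Variables (R : realFieldType) (d : nat) (f : 'I_d -> R).

Lemma sum_ge_one (p : 'I_d) : (forall i, i != p -> 1 <= f i) ->
  f p + (d%:R - 1) <= \sum_i f i.
Proof.
move=> f1; have -> : \sum_i f i = \sum_i (f i - 1) + d%:R.
  by rewrite sumrB sumr_const card_ord subrK.
rewrite (bigD1 p) //=; set S := \sum_(i | _) _.
have : 0 <= S by apply: sumr_ge0 => i /f1; rewrite subr_ge0.
by lra.
Qed.

Lemma sum_ge_two (p q : 'I_d) : p != q ->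
  (forall i, i != p -> i != q -> 1 <= f i) ->
  f p + f q + (d%:R - 2) <= \sum_i f i.
Proof.
move=> pq f1; have -> : \sum_i f i = \sum_i (f i - 1) + d%:R.
  by rewrite sumrB sumr_const card_ord subrK.
rewrite (bigD1 p) //= (bigD1 q) 1?eq_sym //=; set S := \sum_(i | _) _.
have : 0 <= S by apply: sumr_ge0 => i /andP[ip iq]; rewrite subr_ge0 f1.
by lra.
Qed.

End SumBounds.

(** * Peaks of a forest of sibling subtrees *)

Definition peaks (R : realFieldType) (v : nat -> R) (m c : R) (a t e : nat) :
    Prop :=
  [\/ exists2 s, (a < s <= t)%N & m + c - v e <= v s,
      exists2 r, (t < r < e)%N & m + 1 - c - v a <= v r
    | exists s r, [/\ (a < s <= t)%N, (t < r < e)%N & 2 * m <= v s + v r]].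

Section Forest.
Variables (R : realFieldType) (d : nat) (v : 'I_d -> nat -> R) (m c : R).
Variables (a t e : nat).
Hypotheses (d_gt1 : (1 < d)%N) (c_ge0 : 0 <= c) (c_le1 : c <= 1).
Hypotheses (lt_at : (a < t)%N) (lt_te : (t < e)%N).
Hypothesis v_ge0 : forall i s, 0 <= v i s.
Hypothesis v_mid : forall i, 1 <= v i t.
Hypothesis v_peaks : forall i a' e', (a <= a' < t)%N -> (t < e' <= e)%N ->
  v i a' + v i e' < 1 -> peaks (v i) m c a' t e'.

Let F s := \sum_i v i s.
Let M := m + (d%:R - 1) / 2.

Hypothesis F_ends : F a + F e < 1.
Hypothesis F_left : forall s, (a < s <= t)%N -> F s < M + 1 / 2 - F e.
Hypothesis F_right : forall r, (t < r < e)%N -> F r < M + 1 / 2 - F a.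
Hypothesis F_both : forall s r, (a < s <= t)%N -> (t < r < e)%N ->
  F s + F r < 2 * M.

Let good s r := forall i, 1 <= v i s + v i r.
Let bad i s r := [/\ (a <= s < t)%N, (t < r <= e)%N & v i s + v i r < 1].

Lemma forestD s r : F s + F r = \sum_i (v i s + v i r).
Proof. by rewrite /F big_split. Qed.

Lemma d_ge2 : 2 <= d%:R :> R.
Proof. by rewrite ler_nat. Qed.

Lemma goodVbad s r : (a <= s <= t)%N -> (t <= r <= e)%N ->
  good s r \/ exists i, bad i s r.
Proof.
move=> sat rte; have [[i lt_i]|nbad] := pselect (exists i, v i s + v i r < 1).
  right; exists i; split=> //.
    have [Es|] := eqVneq s t; last nat_range.
    by have := v_mid i; have := v_ge0 i r; move: lt_i; rewrite Es; lra.
  have [Er|] := eqVneq r t; last nat_range.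
  by have := v_mid i; have := v_ge0 i s; move: lt_i; rewrite Er; lra.
by left=> i; rewrite leNgt; apply/negP => lt_i; apply: nbad; exists i.
Qed.

(** The other [d - 1] siblings weigh at least 1 each on [s] and [r] together, and
    [2 * M = 2 * m + (d - 1)]. *)
Lemma good_pair s r p : (a < s <= t)%N -> (t < r < e)%N -> good s r ->
  v p s + v p r < 2 * m.
Proof.
move=> sat rte gsr; have := F_both sat rte.
have := @sum_ge_one _ _ (fun i => v i s + v i r) p (fun i _ => gsr i).
by rewrite forestD /M /=; lra.
Qed.

(* A peak found on the left of one bad pair survives when the right end is moved
   anywhere in the good rectangle. *)
Lemma left_peak_move p al be sg s0 :
  bad p al be -> (sg <= e)%N ->
  (forall s r, (al < s <= t)%N -> (t <= r <= sg)%N -> good s r) ->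
  (al < s0 <= t)%N -> m + c - v p be <= v p s0 ->
  forall rho, (t <= rho <= sg)%N ->
  exists2 s, (al < s <= t)%N & m + c - v p rho <= v p s.
Proof.
move=> [al_r be_r bad_p] sge rect s0r s0p rho rhor.
have [le_rho|lt_rho] := leP (v p be) (v p rho); first by exists s0 => //; lra.
have t_rho : (t < rho)%N.
  have [E|] := eqVneq rho t; last nat_range.
  by have := v_mid p; have := v_ge0 p al; move: lt_rho; rewrite E; lra.
have rhoe : (t < rho <= e)%N by nat_range.
(* The pair [al], [rho] is bad for [p] as well, hence has peaks of its own. A right one would add up
   with [s0] to more than [2 * m]. *)
have lt1 : v p al + v p rho < 1 by lra.
have [//|[r rr rp]|[s [r [sr rr srp]]]] := v_peaks al_r rhoe lt1.
  have := @good_pair s0 r p ltac:(nat_range) ltac:(nat_range) (rect s0 r s0r ltac:(nat_range)); lra.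
have := @good_pair s r p ltac:(nat_range) ltac:(nat_range) (rect s r sr ltac:(nat_range)); lra.
Qed.

(** Time reversal of [left_peak_move], with [1 - c] in place of [c]. *)
Lemma right_peak_move q al be tau r0 :
  bad q al be -> (a <= tau)%N ->
  (forall s r, (tau <= s <= t)%N -> (t <= r < be)%N -> good s r) ->
  (t < r0 < be)%N -> m + 1 - c - v q al <= v q r0 ->
  forall rho, (tau <= rho <= t)%N ->
  exists2 r, (t < r < be)%N & m + 1 - c - v q rho <= v q r.
Proof.
move=> [al_r be_r bad_q] taua rect r0r r0p rho rhor.
have [le_rho|lt_rho] := leP (v q al) (v q rho); first by exists r0 => //; lra.
have t_rho : (rho < t)%N.
  have [E|] := eqVneq rho t; last nat_range.
  by have := v_mid q; have := v_ge0 q be; move: lt_rho; rewrite E; lra.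
have rhoa : (a <= rho < t)%N by nat_range.
have lt1 : v q rho + v q be < 1 by lra.
have [[s sr sp]|//|[s [r [sr rr srp]]]] := v_peaks rhoa be_r lt1.
  have := @good_pair s r0 q ltac:(nat_range) ltac:(nat_range) (rect s r0 ltac:(nat_range) ltac:(nat_range)); lra.
have := @good_pair s r q ltac:(nat_range) ltac:(nat_range) (rect s r ltac:(nat_range) ltac:(nat_range)); lra.
Qed.

(* Among the bad pairs with right end at most [sg], one whose left end is the
   closest to [t] and then whose right end is the closest to [t]. *)
Lemma inner_bad_pair sg : (t <= sg <= e)%N ->
  (exists i s r, bad i s r /\ (r <= sg)%N) ->
  exists p al be, [/\ bad p al be, (be <= sg)%N,
    forall s r, (al < s <= t)%N -> (t <= r <= sg)%N -> good s r &
    forall r, (t <= r < be)%N -> good al r].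
Proof.
move=> sgr [i [s [r [bisr rsg]]]].
pose P s := exists i r, bad i s r /\ (r <= sg)%N.
have [||al [[p [r1 [br1 r1sg]]] almax]] := @ex_greatest_nat P t.
- by exists s, i, r.
- by move=> k [j [r' [[? ? ?] _]]]; nat_range.
pose Q r := exists i, bad i al r.
have [|be [[p' bbe] bemin]] := @ex_least_nat Q; first by exists r1, p.
exists p', al, be; have [alr ber _] := bbe.
have besg : (be <= r1)%N by apply: bemin; exists p.
split=> //; first nat_range.
  move=> s' r' s'r r'r; have [//|[j bj]] := @goodVbad s' r' ltac:(nat_range) ltac:(nat_range).
  have := almax s' (ex_intro _ j (ex_intro _ r' (conj bj _))); nat_range.
move=> r' r'r; have [//|[j bj]] := @goodVbad al r' ltac:(nat_range) ltac:(nat_range).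
have := bemin r' (ex_intro _ j bj); nat_range.
Qed.

(** Here [al], [be] is an innermost bad pair: it becomes good as soon as either end moves towards
    [t]. The subtree [q] has a right peak on it. *)
Let right_labelled be := exists q al r0, [/\ bad q al be,
  (forall s r, (al < s <= t)%N -> (t <= r <= be)%N -> good s r),
  (forall s r, (al <= s <= t)%N -> (t <= r < be)%N -> good s r),
  (t < r0 < be)%N & m + 1 - c - v q al <= v q r0].

Lemma inner_bad_pair_label sg p al be : (t <= sg <= e)%N ->
  bad p al be -> (be <= sg)%N ->
  (forall s r, (al < s <= t)%N -> (t <= r <= sg)%N -> good s r) ->
  (forall r, (t <= r < be)%N -> good al r) ->
  right_labelled be \/
  exists2 s0, (al < s0 <= t)%N & m + c - v p be <= v p s0.
Proof.
move=> sgr bpab besg g1 g2; have [alr ber lt1] := bpab.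
have [?|[r rr rp]|[s [r [sr rr srp]]]] := v_peaks alr ber lt1; [by right|left|].
  exists p, al, r; split=> // s' r' s'r r'r; first by apply: g1; nat_range.
  by have [->|] := eqVneq s' al; [apply: g2 | move=> ?; apply: g1; lia].
have := @good_pair s r p ltac:(nat_range) ltac:(nat_range) (g1 s r ltac:(nat_range) ltac:(nat_range)); lra.
Qed.

(** At the step of the staircase with [al] closest to [t], a left peak could be moved to [rho = e].
    Then [F s + F e >= m + c + d - 1 >= M + 1 / 2], as [d >= 2], against [F_left]. *)
Lemma ex_right_labelled : exists be, right_labelled be.
Proof.
have d2 := d_ge2; have c0 := c_ge0; have c1 := c_le1.
have ex_bad : exists i s r, bad i s r /\ (r <= e)%N.
  have [gae|[i bi]] := @goodVbad a e ltac:(nat_range) ltac:(nat_range); last first.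
    by exists i, a, e.
  pose p := Ordinal (ltnW d_gt1).
  have := @sum_ge_one _ _ (fun i => v i a + v i e) p (fun i _ => gae i).
  by have := gae p; rewrite -forestD /=; move: F_ends d2; lra.
have er : (t <= e <= e)%N by nat_range.
have [p [al [be [bpab bee g1 g2]]]] := inner_bad_pair er ex_bad.
have [?|[s0 s0r s0p]] := inner_bad_pair_label er bpab bee g1 g2; first by exists be.
have [s sr sp] := left_peak_move bpab (leqnn e) g1 s0r s0p er.
have [alr _ _] := bpab.
exfalso; have := @F_left s ltac:(nat_range).
have := @sum_ge_one _ _ (fun i => v i s + v i e) p (fun i _ => g1 s e sr er i).
rewrite -forestD /M /=; lra.
Qed.

Lemma forest_contradiction : False.
Proof.
have d2 := d_ge2; have c0 := c_ge0; have c1 := c_le1.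
(* The least [be] gives the last right peak along the staircase, so that the next step, if any,
   carries a left peak. *)
have [be [[q [al [r0 [bq g1 g2 r0r r0p]]]] bemin]] :=
  ex_least_nat ex_right_labelled.
have [alr ber ltq] := bq.
have sgr : (t <= be.-1 <= e)%N by nat_range.
have [ex_bad|nbad] :=
    pselect (exists i s r, bad i s r /\ (r <= be.-1)%N); last first.
  have ga s r : (a <= s <= t)%N -> (t <= r < be)%N -> good s r.
    move=> sr rr; have [//|[i bi]] := @goodVbad s r ltac:(nat_range) ltac:(nat_range).
    by case: nbad; exists i, s, r; split=> //; nat_range.
  (* At the end of the staircase the right peak can be moved to [a], against [F_right]. *)
  have [r rr rp] := right_peak_move bq (leqnn a) ga r0r r0p
    (rho := a) ltac:(nat_range).
  have := @F_right r ltac:(nat_range).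
  have := @sum_ge_one _ _ (fun i => v i a + v i r) q
    (fun i _ => ga a r ltac:(nat_range) ltac:(nat_range) i).
  by rewrite -forestD /M /=; lra.
have [p [al' [be' [bp be's g3 g4]]]] := inner_bad_pair sgr ex_bad.
have [al'r be'r ltp] := bp.
have [/bemin|[s0 s0r s0p]] := inner_bad_pair_label sgr bp be's g3 g4; first nat_range.
have al'al : (al' < al)%N.
  rewrite ltnNge; apply/negP => le_al.
  by have := @g2 al' be' ltac:(nat_range) ltac:(nat_range) p; lra.
have g s r : (al' < s <= t)%N -> (t < r < be)%N -> good s r.
  by move=> sr rr; apply: g3; nat_range.
have [eq_pq|ne_pq] := eqVneq p q.
  (* Two bad pairs and the good pair [al], [be'] between them make the outer pair [al'], [be] bad
     for [p]. Each kind of peak on it contradicts [good_pair]. *)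
  subst q; have := g3 al be' ltac:(nat_range) ltac:(nat_range) p => gp.
  have lt1 : v p al' + v p be < 1 by lra.
  have [[s sr sp]|[r rr rp]|[s [r [sr rr srp]]]] := v_peaks al'r ber lt1.
  - have := @good_pair s r0 p ltac:(nat_range) ltac:(nat_range) (g s r0 ltac:(nat_range) ltac:(nat_range)); lra.
  - have := @good_pair s0 r p ltac:(nat_range) ltac:(nat_range) (g s0 r ltac:(nat_range) ltac:(nat_range)); lra.
  - have := @good_pair s r p ltac:(nat_range) ltac:(nat_range) (g s r ltac:(nat_range) ltac:(nat_range)); lra.
(* The left peak is moved to [b], the right one to [s]. The losses [v p b] and [v q s] are made up
   by [v p r >= v p b] and by [v q s] itself. *)
have [b br bmin] := @ex_argmin_nat R (v p) t be.-1 ltac:(nat_range).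
have [s sr sp] := left_peak_move bp (sg := be.-1) ltac:(nat_range) g3 s0r s0p br.
have [r rr rp] := right_peak_move bq (tau := al'.+1) ltac:(nat_range)
  (fun s r sr rr => g3 s r ltac:(nat_range) ltac:(nat_range)) r0r r0p (rho := s) ltac:(nat_range).
have := @F_both s r ltac:(nat_range) ltac:(nat_range).
have gsr := g s r sr rr; have := bmin r ltac:(nat_range).
have := @sum_ge_two _ _ (fun i => v i s + v i r) p q ne_pq (fun i _ _ => gsr i).
by rewrite -forestD /M /=; lra.
Qed.

End Forest.

Lemma forest_peaks (R : realFieldType) (d : nat) (v : 'I_d -> nat -> R)
    (m c : R) (a t e : nat) :
  (1 < d)%N -> 0 <= c -> c <= 1 -> (a < t)%N -> (t < e)%N ->
  (forall i s, 0 <= v i s) -> (forall i, 1 <= v i t) ->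
  (forall i a' e', (a <= a' < t)%N -> (t < e' <= e)%N ->
    v i a' + v i e' < 1 -> peaks (v i) m c a' t e') ->
  \sum_i v i a + \sum_i v i e < 1 ->
  peaks (fun s => \sum_i v i s) (m + (d%:R - 1) / 2) (1 / 2) a t e.
Proof.
move=> d2 c0 c1 lt_at lt_te v0 vt vP Fae; apply: contrapT => nP.
apply: (forest_contradiction d2 c0 c1 lt_at lt_te v0 vt vP Fae).
- move=> s sr; rewrite ltNge; apply/negP => le_s.
  by apply: nP; constructor 1; exists s.
- move=> r rr; rewrite ltNge; apply/negP => le_r.
  by apply: nP; constructor 2; exists r => //; lra.
- move=> s r sr rr; rewrite ltNge; apply/negP => le_sr.
  by apply: nP; constructor 3; exists s, r.
Qed.

(** * From the peaks of the children to those of the parent *)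

Lemma nonready_mono (R : realFieldType) (b w : nat -> R) (ready : pred nat)
    (a e : nat) :
  (forall t, (a <= t < e)%N -> ~~ ready t -> b t.+1 <= b t /\ w t <= w t.+1) ->
  forall x y, (a <= x)%N -> (x <= y <= e)%N ->
  (forall t, (x <= t < y)%N -> ~~ ready t) -> b y <= b x /\ w x <= w y.
Proof.
move=> step x + ax; elim=> [|y IHy] xye nready.
  by rewrite (_ : x = 0%N) ?lexx//; nat_range.
have [->//|xy] := eqVneq x y.+1.
have [|b1 w1] := IHy ltac:(nat_range); first by move=> t ?; apply: nready; nat_range.
have [b2 w2] := step y ltac:(nat_range) (nready y ltac:(nat_range)).
by split; [exact: le_trans b1 | exact: le_trans w2].
Qed.

Section Tree.
Variables (R : realFieldType) (b w F : nat -> R) (ready : pred nat).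
Variables (a t e : nat).
Hypotheses (lt_at : (a < t)%N) (lt_te : (t < e)%N).
Hypotheses (b_ge0 : forall s, 0 <= b s) (w_ge0 : forall s, 0 <= w s).
Hypothesis F_ge0 : forall s, 0 <= F s.
Hypothesis step : forall s, (a <= s < e)%N -> ~~ ready s ->
  b s.+1 <= b s /\ w s <= w s.+1.
Hypothesis ready_F : forall s, ready s -> 1 <= F s.
Hypothesis root_full : b t + w t = 1.

Let V s := b s + w s + F s.

Hypothesis V_ends : V a + V e < 1.

Lemma treeE s : V s = b s + w s + F s. Proof. by []. Qed.

(** Without a ready time before [t], [b t <= b a <= V a]; without one after, [w t <= w e <= V e].
    Both cannot happen, as [b t + w t = 1]. *)
Lemma ready_cases :
  [\/ (exists t1, [/\ (a < t1 < t)%N, ready t1 &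
        forall s, (t1 < s <= t)%N -> b t <= b s]) /\ 1 - V e <= b t,
      (exists t2, [/\ (t <= t2 < e)%N, ready t2 &
        forall s, (t <= s <= t2)%N -> w t <= w s]) /\ 1 - V a <= w t
    | (exists t1, [/\ (a < t1 < t)%N, ready t1 &
        forall s, (t1 < s <= t)%N -> b t <= b s]) /\
      (exists t2, [/\ (t <= t2 < e)%N, ready t2 &
        forall s, (t <= s <= t2)%N -> w t <= w s])].
Proof.
have mono := nonready_mono step; have full := root_full; have ends := V_ends.
have bwa := b_ge0 a; have wa := w_ge0 a; have Fa := F_ge0 a.
have be := b_ge0 e; have we := w_ge0 e; have Fe := F_ge0 e.
have left : (exists t1, [/\ (a < t1 < t)%N, ready t1 &
    forall s, (t1 < s <= t)%N -> b t <= b s]) \/ b t <= V a.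
  have [exR|nR] := pselect (exists s, (a <= s < t)%N /\ ready s).
    have [|t1 [[t1r Rt1] t1max]] := ex_greatest_nat exR (N := t).
      by move=> s []; nat_range.
    left; exists t1; split=> //.
      have [E|] := eqVneq t1 a; last nat_range.
      by have := ready_F Rt1; move: V_ends; rewrite !treeE E; lra.
    move=> s sr; have [|//] := mono s t ltac:(nat_range) ltac:(nat_range).
    by move=> s' s'r; apply/negP => Rs'; have := t1max s' ltac:(split=> //; nat_range); nat_range.
  right; have [|bt _] := mono a t (leqnn a) ltac:(nat_range).
    by move=> s sr; apply/negP => Rs; apply: nR; exists s.
  by rewrite treeE; lra.
have right : (exists t2, [/\ (t <= t2 < e)%N, ready t2 &
    forall s, (t <= s <= t2)%N -> w t <= w s]) \/ w t <= V e.
  have [exR|nR] := pselect (exists s, (t <= s < e)%N /\ ready s).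
    have [t2 [[t2r Rt2] t2min]] := ex_least_nat exR.
    left; exists t2; split=> //.
    move=> s sr; have [|//] := mono t s ltac:(nat_range) ltac:(nat_range).
    by move=> s' s'r; apply/negP => Rs'; have := t2min s' ltac:(split=> //; nat_range); nat_range.
  right; have [|_ wt] := mono t e ltac:(nat_range) ltac:(nat_range).
    by move=> s sr; apply/negP => Rs; apply: nR; exists s.
  by rewrite treeE; lra.
case: left right => [L|bV] [Rt|wV].
- by constructor 3.
- by constructor 1; split=> //; lra.
- by constructor 2; split=> //; lra.
- by move: V_ends; lra.
Qed.

(** A right peak of [F] around [t1] that falls before [t] becomes a left peak of [V], raised by the
    black weight [b t] still present. After [t] the same holds with [w t]. *)
Lemma tree_peaks (M : R) :
  (forall s, (a < s < e)%N -> ready s -> peaks F M (1 / 2) a s e) ->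
  peaks V M (1 / 2) a t e.
Proof.
move=> ready_peaks; have full := root_full; have ends := V_ends.
have FV s : F s <= V s by rewrite treeE; have := b_ge0 s; have := w_ge0 s; lra.
have Va := FV a; have Ve := FV e; have Fa := F_ge0 a; have Fe := F_ge0 e.
have bt := b_ge0 t; have wt := w_ge0 t.
have left t1 : (a < t1 < t)%N -> ready t1 ->
    (forall s, (t1 < s <= t)%N -> b t <= b s) ->
    peaks V M (1 / 2) a t e \/ exists2 x, (a < x <= t)%N &
      M + 1 / 2 - F a + b t <= V x \/ M + b t / 2 <= V x.
  move=> t1r Rt1 bt1.
  have Vb s : (t1 < s <= t)%N -> F s + b t <= V s.
    by move=> /bt1; rewrite treeE; have := w_ge0 s; lra.
  have [[s sr sp]|[r rr rp]|[s [r [sr rr srp]]]] :=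
      ready_peaks t1 ltac:(nat_range) Rt1.
  - by left; constructor 1; exists s; [nat_range | have := FV s; lra].
  - have [rt|tr] := leqP r t; last first.
      by left; constructor 2; exists r; [nat_range | have := FV r; lra].
    by right; exists r; [nat_range | left; have := Vb r ltac:(nat_range); lra].
  - have [rt|tr] := leqP r t; last first.
      left; constructor 3; exists s, r; split; [nat_range|nat_range|].
      by have := FV s; have := FV r; lra.
    (* Both peaks lie before [t]: if [F s] is below this threshold, [F r] exceeds [M - b t / 2] and
       gains [b t]. *)
    right; have [Fs|Fs] := leP (M + b t / 2) (F s).
      by exists s; [nat_range | right; have := FV s; lra].
    by exists r; [nat_range | right; have := Vb r ltac:(nat_range); lra].
have right t2 : (t <= t2 < e)%N -> ready t2 ->
    (forall s, (t <= s <= t2)%N -> w t <= w s) ->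
    peaks V M (1 / 2) a t e \/ exists2 y, (t < y < e)%N &
      M + 1 / 2 - F e + w t <= V y \/ M + w t / 2 <= V y.
  move=> t2r Rt2 wt2.
  have Vw s : (t < s <= t2)%N -> F s + w t <= V s.
    by move=> sr; have := wt2 s ltac:(nat_range); rewrite treeE; have := b_ge0 s; lra.
  have [[s sr sp]|[r rr rp]|[s [r [sr rr srp]]]] :=
      ready_peaks t2 ltac:(nat_range) Rt2.
  - have [st|ts] := leqP s t.
      by left; constructor 1; exists s; [nat_range | have := FV s; lra].
    by right; exists s; [nat_range | left; have := Vw s ltac:(nat_range); lra].
  - by left; constructor 2; exists r; [nat_range | have := FV r; lra].
  - have [st|ts] := leqP s t.
      left; constructor 3; exists s, r; split; [nat_range|nat_range|].
      by have := FV s; have := FV r; lra.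
    right; have [Fr|Fr] := leP (M + w t / 2) (F r).
      by exists r; [nat_range | right; have := FV r; lra].
    by exists s; [nat_range | right; have := Vw s ltac:(nat_range); lra].
case: ready_cases => [[[t1 [t1r Rt1 bt1]] bV]|[[t2 [t2r Rt2 wt2]] wV]|
    [[t1 [t1r Rt1 bt1]] [t2 [t2r Rt2 wt2]]]].
- have [//|[x xr xp]] := left t1 t1r Rt1 bt1.
  by constructor 1; exists x => //; case: xp; lra.
- have [//|[y yr yp]] := right t2 t2r Rt2 wt2.
  by constructor 2; exists y => //; case: yp; lra.
- have [//|[x xr xp]] := left t1 t1r Rt1 bt1.
  have [//|[y yr yp]] := right t2 t2r Rt2 wt2.
  by constructor 3; exists x, y; split=> //; case: xp; case: yp; lra.
Qed.

Lemma star_peaks (M : R) : (forall s, ready s -> M <= F s) -> peaks V M 0 a t e.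
Proof.
move=> readyM; have full := root_full; have ends := V_ends.
have bt := b_ge0 t; have wt := w_ge0 t.
have V0 s : 0 <= V s.
  by rewrite treeE; have := b_ge0 s; have := w_ge0 s; have := F_ge0 s; lra.
have Ve := V0 e.
have left t1 : (a < t1 <= t)%N -> ready t1 -> peaks V M 0 a t e.
  move=> t1r Rt1; constructor 1; exists t1 => //.
  rewrite [leRHS]treeE; have := readyM t1 Rt1.
  by have := b_ge0 t1; have := w_ge0 t1; lra.
case: ready_cases => [[[t1 [t1r Rt1 _]] _]|[[t2 [t2r Rt2 wt2]] wV]|
    [[t1 [t1r Rt1 _]] _]]; try by apply: left Rt1; nat_range.
(* The time [t] itself counts as a left one. *)
have [E|ne] := eqVneq t2 t; first by apply: left Rt2; nat_range.
constructor 2; exists t2; first nat_range.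
rewrite [leRHS]treeE; have := readyM t2 Rt2; have := wt2 t2 ltac:(nat_range).
by have := b_ge0 t2; lra.
Qed.

End Tree.

(** * Subtrees of a pebbled tree *)

Section PebbledTree.
Variables (R : realType) (d h : nat).

Lemma childP (x y : node d h) :
  reflect (exists i, y = rcons x i :> seq 'I_d) (child x y).
Proof. by apply: (iffP existsP) => -[i /eqP]; exists i => //; apply/eqP. Qed.

(** At a leaf the address is too long and [insub_bseq] returns a default, hence the height condition
    in [branchE]. *)
Definition branch (x : node d h) (i : 'I_d) : node d h :=
  insub_bseq h.-1 (rcons x i).

Lemma branchE (x : node d h) (i : 'I_d) : ((size x).+1 < h)%N ->
  branch x i = rcons x i :> seq 'I_d.
Proof.
move=> xh; rewrite /branch /insub_bseq insubdK //.
by rewrite unfold_in /= size_rcons -ltnS (ltn_predK xh).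
Qed.

Lemma child_branch (x : node d h) (i : 'I_d) : ((size x).+1 < h)%N ->
  child x (branch x i).
Proof. by move=> xh; apply/childP; exists i; rewrite branchE. Qed.

Definition subtree_weight (c : config R d h) (x : node d h) : R :=
  \sum_(y : node d h | prefix x y) pebble c y.

Lemma pebble_ge0 (c : config R d h) (x : node d h) : 0 <= pebble c x.
Proof. by rewrite addr_ge0 ?black_ge0 ?white_ge0. Qed.

Lemma subtree_weight_ge0 (c : config R d h) (x : node d h) : 0 <= subtree_weight c x.
Proof. by apply: sumr_ge0 => y _; apply: pebble_ge0. Qed.

Lemma pebble_le_subtree_weight (c : config R d h) (x : node d h) :
  pebble c x <= subtree_weight c x.
Proof.
rewrite /subtree_weight (bigD1 x) ?prefix_refl //= lerDl.
by apply: sumr_ge0 => y _; apply: pebble_ge0.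
Qed.

Lemma subtree_weight_branch (c : config R d h) (x : node d h) : ((size x).+1 < h)%N ->
  subtree_weight c x = pebble c x + \sum_i subtree_weight c (branch x i).
Proof.
move=> xh; rewrite /subtree_weight (bigD1 x) ?prefix_refl //=; congr (_ + _).
(* [i0] serves as default for [nth], which sorts the proper descendants by the letter after [x]. *)
have [i0 _|d0] := pickP {: 'I_d}; last first.
  rewrite [RHS]big1 => [|i _]; last by have := d0 i.
  apply: big1 => y /andP[/prefixP[s E] /eqP ne]; case: s E => [|i s] E.
    by case: ne; apply/val_inj; rewrite /= E cats0.
  by have := d0 i.
rewrite (partition_big (fun y : node d h => nth i0 y (size x)) predT) //=.
apply: eq_bigr => i _; apply: eq_bigl => y; rewrite branchE //.
apply/andP/idP => [[/andP[/prefixP[s E] /eqP ne] /eqP Ei]|/prefixP[s E]].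
  case: s E => [|j s] E.
    by case: ne; apply/val_inj; rewrite /= E cats0.
  move: Ei; rewrite E nth_cat ltnn subnn /= => <-.
  by apply/prefixP; exists s; rewrite cat_rcons.
rewrite E nth_cat size_rcons ltnSn nth_rcons ltnn eqxx eqxx; split=> //.
apply/andP; split.
  by apply/prefixP; exists (i :: s); rewrite cat_rcons.
apply/eqP => Exy; have := congr1 size E.
by move=> /eqP; rewrite Exy size_cat size_rcons addSn -addnS -[X in X == _]addn0 eqn_add2l.
Qed.

Definition ready (c : config R d h) (x : node d h) : bool :=
  [forall i, pebble c (branch x i) == 1].

(** Only [compute_node] raises the black or lowers the white weight of an inner node, and it needs
    all children full. *)
Lemma move_nonready (c c' : config R d h) (x : node d h) : ((size x).+1 < h)%N -> (0 < d)%N ->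
  move c c' -> ~~ ready c x -> black c' x <= black c x /\ white c x <= white c' x.
Proof.
move=> xh d0 [i bi bj wj|i full wi bi bch bj wj|i wi pi wj bj|i lf bi bj wj] nr.
- by rewrite wj lexx; have [->|/bj ->] := eqVneq x i.
- have [E|ne] := eqVneq x i; last first.
    rewrite (wj x ne) lexx; split=> //; have [/bch//|nch] := boolP (child i x).
    by rewrite (bj x ne nch).
  by case/negP: nr; apply/forallP => k; apply/eqP/full; rewrite -E child_branch.
- by rewrite bj lexx; have [->|/wj ->] := eqVneq x i.
- have [E|ne] := eqVneq x i; last by rewrite wj bj // !lexx.
  case/negP: lf; apply/existsP; exists (branch x (Ordinal d0)).
  by rewrite -E child_branch.
Qed.

Lemma ready_weight (c : config R d h) (x : node d h) : ready c x ->
  d%:R <= \sum_i subtree_weight c (branch x i).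
Proof.
move=> /forallP rd; rewrite -[d in d%:R]card_ord -sumr_const.
by apply: ler_sum => i _; rewrite -(eqP (rd i)) pebble_le_subtree_weight.
Qed.

(* Trees of height 2 satisfy [peaks] with parameter [0] but not [1 / 2]. *)
Lemma subtree_peaks (n : nat) (c : nat -> config R d h) : (1 < d)%N ->
  pebbling n c -> forall k, exists2 c0, 0 <= c0 <= 1 &
  forall (x : node d h) a t e, (size x + k.+2 = h)%N ->
    (a < t)%N -> (t < e <= n)%N -> pebble (c t) x = 1 ->
    subtree_weight (c a) x + subtree_weight (c e) x < 1 ->
    peaks (fun s => subtree_weight (c s) x) (min_weight R d k.+2) c0 a t e.
Proof.
move=> d2 pc; have d1 : 1 <= d%:R :> R by rewrite ler1n ltnW.
have height k (x : node d h) : (size x + k.+2 = h -> (size x).+1 < h)%N.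
  by move: (size x) => m; lia.
have step (x : node d h) a e : ((size x).+1 < h)%N -> (e <= n)%N ->
    forall s, (a <= s < e)%N -> ~~ ready (c s) x ->
    black (c s.+1) x <= black (c s) x /\ white (c s) x <= white (c s.+1) x.
  by move=> xh en s sr; apply: move_nonready; [|exact: ltnW|apply: pc; nat_range].
have ready1 (x : node d h) s : ready (c s) x ->
    1 <= \sum_i subtree_weight (c s) (branch x i).
  by move=> /ready_weight; exact: le_trans.
have sum_ge0 (x : node d h) s : 0 <= \sum_i subtree_weight (c s) (branch x i).
  by apply: sumr_ge0 => i _; apply: subtree_weight_ge0.
have VE (x : node d h) : ((size x).+1 < h)%N ->
    (fun s => subtree_weight (c s) x) = (fun s => black (c s) x +
      white (c s) x + \sum_i subtree_weight (c s) (branch x i)).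
  by move=> xh; apply/funext => s; rewrite subtree_weight_branch.
elim=> [|k [c1 /andP[c1_ge0 c1_le1] IHk]].
  exists 0 => [|x a t e /height xh lt_at te full ends]; first by rewrite lexx ler01.
  rewrite VE //; apply: (@star_peaks R _ _ _ (fun s => ready (c s) x)) => //.
  - by nat_range.
  - by move=> s; apply: black_ge0.
  - by move=> s; apply: white_ge0.
  - by apply: step => //; nat_range.
  - by move=> s /ready1.
  - by rewrite !subtree_weight_branch in ends.
  (* The bound for height 2 is [d]. *)
  - by move=> s /ready_weight; rewrite /min_weight; lra.
exists (1 / 2) => [|x a t e xk lt_at te full ends]; first lra.
have xh := height _ _ xk.
rewrite VE //; apply: (@tree_peaks R _ _ _ (fun s => ready (c s) x)) => //.
- by nat_range.
- by move=> s; apply: black_ge0.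
- by move=> s; apply: white_ge0.
- by apply: step => //; nat_range.
- by move=> s /ready1.
- by rewrite !subtree_weight_branch in ends.
move=> s sr /forallP rd.
have -> : min_weight R d k.+3 = min_weight R d k.+2 + (d%:R - 1) / 2.
  by rewrite /min_weight -[k.+3]addn1 natrD; lra.
apply: (forest_peaks (c := c1)) => //; try nat_range.
- by move=> i r; apply: subtree_weight_ge0.
- by move=> i; rewrite -(eqP (rd i)) pebble_le_subtree_weight.
- move=> i a' e' a'r e'r ends'; apply: IHk => //; try nat_range.
    by rewrite branchE // size_rcons addSnnS.
  exact/eqP.
- apply: le_lt_trans ends; rewrite !(subtree_weight_branch _ xh).
  by rewrite lerD // lerDr pebble_ge0.
Qed.

End PebbledTree.

(** * Application to the whole tree *)

Theorem mainTheorem1 (R : realType) (d h : nat) (hd : (2 <= d)%N)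
    (hh : (2 <= h)%N) (n : nat) (c : nat -> config R d h)
    (hc : root_pebbling n c) :
  exists2 t : nat, (t <= n)%N & min_weight R d h <= weight (c t).
Proof.
case: hc => pc c0 cn [t tn ct].
have wE s : subtree_weight (c s) (root_node d h) = weight (c s).
  by apply: eq_bigl => y; rewrite prefix0s.
have w0 : weight (c 0%N) = 0 by apply: big1 => i _.
have wn : weight (c n) = 0 by apply: big1 => i _.
have t0 : t != 0%N.
  by apply/eqP => E; move: ct; rewrite E c0 => /eqP; rewrite eq_sym oner_eq0.
have tn' : t != n.
  by apply/eqP => E; move: ct; rewrite E cn => /eqP; rewrite eq_sym oner_eq0.
have [k hk] : exists k, h = k.+2 by exists h.-2; nat_range.
have [c1 /andP[c1_ge0 c1_le1] IH] := subtree_peaks hd pc k.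
have {IH} := IH (root_node d h) 0%N t n.
rewrite !wE w0 wn addr0 -hk => /(_ _ _ _ ct ltr01).
case=> //; try nat_range.
(* The tree is empty at both ends and [0 <= c1 <= 1], so any single peak reaches the bound. *)
- by move=> [s sr]; rewrite !wE wn => sp; exists s; [nat_range|lra].
- by move=> [s sr]; rewrite !wE w0 => sp; exists s; [nat_range|lra].
- move=> [s [r [sr rr]]]; rewrite !wE => srp.
  have [ls|ls] := leP (min_weight R d h) (weight (c s)); first by exists s; [nat_range|].
  by exists r; [nat_range|lra].
Qed.
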